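(* Let $K = \mathbf{R}$ or $K = \mathbf{C}$, and let $h \geq 2$ and $n \geq 2$ be integers. Let $\mathcal{B}_h \subseteq K^n$ be the set of all $B_h$-vectors in $K^n$. Then $\mathcal{B}_h$ is a dense open subset of $K^n$.
   Context: A subset $A$ of $K$ is called a $B_h$-set if every element of $K$ has at most one representation (up to permutation of the summands) as the sum of $h$ not necessarily distinct elements of $A$. A vector $\mathbf{a} = (a_1,\ldots,a_n) \in K^n$ is called a $B_h$-vector if its coordinates $a_1,\ldots,a_n$ are pairwise distinct and the associated $n$-element set $A = \{a_1,\ldots,a_n\}$ is a $B_h$-set. The space $K^n$ carries its usual topology, given for instance by the norm $\|\mathbf{a}\|_\infty = \max_{1 \le i \le n} |a_i|$. *)

(* Defs.v *)
From mathcomp Require Import all_boot all_order all_algebra complex.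
From mathcomp Require Import all_classical all_reals all_analysis.
Set Implicit Arguments.
Unset Strict Implicit.
Unset Printing Implicit Defensive.
Import Order.TTheory GRing.Theory Num.Theory.
Import numFieldNormedType.Exports.
Local Open Scope classical_set_scope.
Local Open Scope ring_scope.

(* [s] lists, in some order and with multiplicity, the [h] summands of a
   representation of [x]; two tuples are the same representation exactly when
   they are related by [perm_eq]. *)
Definition represents (K : numFieldType) (h : nat) (A : set K) (x : K)
    (s : h.-tuple K) : Prop :=
  (forall y, y \in s -> A y) /\ x = \sum_(y <- s) y.

Definition Bh_set (K : numFieldType) (h : nat) (A : set K) : Prop :=
  forall (x : K) (s t : h.-tuple K),
    represents A x s -> represents A x t -> perm_eq s t.

Definition Bh_vector (K : numFieldType) (h n : nat) (a : 'rV[K]_n) : Prop :=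
  injective (a ord0) /\ Bh_set h (range (a ord0)).

(* Stated over a [numFieldType] so that both [R] and [R[i]] carry the topology
   of their absolute value, and ['rV[K]_n] the sup-norm topology. *)
Definition Bh_vectors (K : numFieldType) (h n : nat) : set 'rV[K]_n :=
  [set a | Bh_vector h a].
Arguments Bh_vectors : clear implicits.

(* Main.v *)
(* An index tuple [s] determines the linear form [a |-> \sum_(i <- s) a_i], and
   [a] is a B_h-vector exactly when forms of inequivalent [h]-tuples take
   distinct values at [a] (constant tuples account for the distinctness of the
   coordinates).  So the B_h-vectors are the intersection of finitely many
   complements of hyperplanes, each of which is open and dense. *)

Require Import Defs.
From mathcomp Require Import all_boot all_order all_algebra complex.
From mathcomp Require Import all_classical all_reals all_analysis.
Import numFieldNormedType.Exports.
Local Open Scope complex_scope.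
Import Order.TTheory GRing.Theory Num.Theory.
Local Open Scope classical_set_scope.
Local Open Scope ring_scope.

Definition index_sum {K : numFieldType} {n : nat} (s : seq 'I_n)
  (a : 'rV[K]_n) : K := \sum_(i <- s) a ord0 i.

Lemma index_sumD (K : numFieldType) (n : nat) (s : seq 'I_n) (a b : 'rV[K]_n) :
  index_sum s (a + b) = index_sum s a + index_sum s b.
Proof.
by rewrite /index_sum -big_split; apply: eq_bigr => i _; rewrite mxE.
Qed.

Lemma index_sum_delta (K : numFieldType) (n : nat) (s : seq 'I_n) (i : 'I_n)
    (t : K) :
  index_sum s (t *: delta_mx ord0 i) = t * (count_mem i s)%:R.
Proof.
rewrite /index_sum -sum1_count [in RHS]big_mkcond natr_sum mulr_sumr.
apply: eq_bigr => j _.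
by rewrite !mxE eqxx /=; case: (j == i).
Qed.

Lemma index_sum_continuous (K : numFieldType) (n : nat) (s : seq 'I_n) :
  continuous (@index_sum K n s).
Proof.
move=> a; apply: (@cvg_big _ _ _ _ _ _ _ (nbhs a)) => [|i _].
  exact: add_continuous.
exact: coord_continuous.
Qed.

(** The difference of the two forms is continuous, and the set is its preimage of the complement of
    the closed point 0. *)
Lemma open_index_sum_neq (K : numFieldType) (n : nat) (s t : seq 'I_n) :
  open [set a : 'rV[K]_n | index_sum s a != index_sum t a].
Proof.
have -> : [set a : 'rV[K]_n | index_sum s a != index_sum t a] =
    (fun a => index_sum s a - index_sum t a) @^-1` (~` [set 0]).
  apply/seteqP; split=> a /=; rewrite -subr_eq0.
    by move/eqP.
  by move=> ne; apply/eqP.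
apply: open_comp => [a _|].
  exact: (@cvgB _ _ _ (nbhs a) _ _ _ _ _ (index_sum_continuous _ _ s a)
    (index_sum_continuous _ _ t a)).
apply: closed_openC; apply: accessible_closed_set1.
exact: (hausdorff_accessible (@norm_hausdorff K K)).
Qed.

(** Inequivalent tuples differ in the multiplicity of some index [i]. A point where the forms agree
    can be moved slightly along the [i]-th axis, which changes the two sums by different amounts. *)
Lemma dense_index_sum_neq (K : numFieldType) (n : nat) (s t : seq 'I_n.+1) :
  ~~ perm_eq s t ->
  dense [set a : 'rV[K]_n.+1 | index_sum s a != index_sum t a].
Proof.
move=> st O [a Oa] openO.
have [eqa|nea] := eqVneq (index_sum s a) (index_sum t a); last by exists a.
have /existsP[i ci] : [exists i, count_mem i s != count_mem i t].
  apply: contraNT st => /existsPn ce; apply/allP => i _ /=.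
  by have := ce i; rewrite negbK.
(* The limit is taken over punctured neighbourhoods of 0, so that the displacement found inside [O]
   can be chosen nonzero. *)
have lim : a + x *: delta_mx ord0 i @[x --> (0 : K)^'] --> a.
  have a0 : a = a + 0 *: delta_mx ord0 i by rewrite scale0r addr0.
  rewrite [X in _ --> X]a0; apply: cvgD; first exact: cvg_cst.
  by apply: cvgZr_tmp; apply: cvg_within_filter; exact: cvg_id.
have nearO : \forall x \near (0 : K)^', O (a + x *: delta_mx ord0 i).
  by apply: lim; apply: open_nbhs_nbhs.
have near0 : \forall x \near (0 : K)^', x != 0 by exact: nbhs_dnbhs_neq.
have [x [x0 Ox]] := filter_ex (filterI near0 nearO).
exists (a + x *: delta_mx ord0 i); split=> //=.
(* The common value at [a] cancels, then the factor [x]; what remains are two distinct naturals,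
   which stay distinct in characteristic 0. *)
rewrite !index_sumD eqa (inj_eq (addrI _)) !index_sum_delta.
by rewrite (inj_eq (mulfI x0)) eqr_nat.
Qed.

Lemma index_sum_map (K : numFieldType) (n : nat) (s : seq 'I_n) (a : 'rV[K]_n) :
  index_sum s a = \sum_(y <- map (a ord0) s) y.
Proof. by rewrite big_map. Qed.

Lemma perm_eq_nseq (T : eqType) (h : nat) (x y : T) :
  (0 < h)%N -> perm_eq (nseq h x) (nseq h y) -> x = y.
Proof.
case: h => // h _ /perm_mem/(_ x).
by rewrite mem_head mem_nseq /= => /esym/eqP.
Qed.

(** Choosing a preimage of each entry lifts a representation by elements of the set to a tuple of
    indices. *)
Lemma map_tuple_range (T U : choiceType) (f : T -> U) (h : nat)
    (s : h.-tuple U) :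
  (forall y, y \in s -> range f y) -> exists u : h.-tuple T, s = map_tuple f u.
Proof.
move=> sf.
have ex (j : 'I_h) : {x | f x = tnth s j}.
  by apply: cid; have [x _ <-] := sf _ (mem_tnth j s); exists x.
exists [tuple projT1 (ex j) | j < h]; apply: eq_from_tnth => j.
by rewrite tnth_map tnth_mktuple (projT2 (ex j)).
Qed.

Lemma Bh_vectorP (K : numFieldType) (h n : nat) (a : 'rV[K]_n) : (0 < h)%N ->
  Bh_vector h a <-> forall s t : h.-tuple 'I_n, ~~ perm_eq s t ->
    index_sum s a != index_sum t a.
Proof.
move=> h0; split=> [[inja Bha] s t|neq].
  apply: contraNneq; rewrite !index_sum_map => eqst.
  apply: (perm_map_inj inja).
  have range_map (u : seq 'I_n) y : y \in map (a ord0) u -> range (a ord0) y.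
    by case/mapP=> i _ ->; exists i.
  apply: (Bha _ (map_tuple _ s) (map_tuple _ t)); split => //; exact: range_map.
split=> [i j aij|x _ _ [/map_tuple_range[s ->] ->] [/map_tuple_range[t ->] eqst]].
  (* If [a] agrees at [i] and [j], the constant tuples at [i] and [j] have the same sum, hence are
     equivalent; as [h] is positive, [i = j]. *)
  apply: (@perm_eq_nseq _ h) => //.
  apply: contraT => /(neq (nseq_tuple h i) (nseq_tuple h j)).
  by rewrite !index_sum_map !map_nseq aij eqxx.
apply: perm_map; apply: contraT => /neq.
by rewrite !index_sum_map eqst eqxx.
Qed.

Lemma open_dense_Bh_vectors (K : numFieldType) (h n : nat) : (0 < h)%N ->
  open (Bh_vectors K h n.+1) /\ dense (Bh_vectors K h n.+1).
Proof.
move=> h0.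
have -> : Bh_vectors K h n.+1 =
    \big[setI/setT]_(u : h.-tuple 'I_n.+1 * h.-tuple 'I_n.+1
                    | ~~ perm_eq u.1 u.2)
      [set a | index_sum u.1 a != index_sum u.2 a].
  rewrite -bigcap_seq_cond; apply/seteqP; split=> a.
    by move/(Bh_vectorP _ _ _ _ h0) => neq [s t] /= /andP[_]; exact: neq.
  move=> neq; apply/(Bh_vectorP _ _ _ _ h0) => s t st.
  by apply: (neq (s, t)); rewrite /= st mem_index_enum.
(* Openness and density are carried together, since density of an intersection of two dense sets
   relies on one of them being open. *)
apply: (big_ind (fun A : set 'rV[K]_n.+1 => open A /\ dense A)).
- by split=> [|O [a Oa] _]; [exact: openT|exists a].
- move=> A B [openA denseA] [openB denseB].
  by split; [exact: openI|exact: denseI].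
- by move=> u ne; split; [exact: open_index_sum_neq|exact: dense_index_sum_neq].
Qed.

Theorem theorem3 (R : realType) (h n : nat) (hh : (2 <= h)%N) (hn : (2 <= n)%N) :
  (open (Bh_vectors R h n) /\ dense (Bh_vectors R h n)) /\
  (open (Bh_vectors R[i] h n) /\ dense (Bh_vectors R[i] h n)).
Proof.
by case: n hn => // n _; split; apply: open_dense_Bh_vectors; apply: ltnW.
Qed.
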